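(* A pair $(F,G)\in V_5\oplus V_3$ lies in the null cone $\mathcal{N}_{5,3}$ if and only if there is a point $p\in\mathbb{P}^1$ with $$\mathrm{mult}_p(F)\ge 3\quad\text{and}\quad \mathrm{mult}_p(G)\ge 2.$$
   Context: $k$ is an algebraically closed field of characteristic zero, $V_n$ is the space of binary forms of degree $n$ in $x,y$ over $k$, and $\mathrm{SL}_2(k)$ acts on $V_5\oplus V_3$ by simultaneous linear substitution of variables. $\mathcal{R}=k[V_5\oplus V_3]^{\mathrm{SL}_2}$, graded by total degree. The null cone $\mathcal{N}_{5,3}\subset V_5\oplus V_3$ is the common zero set of all homogeneous elements of $\mathcal{R}$ of positive degree. $\mathrm{mult}_p(f)$ is the multiplicity of $p$ as a zero of the binary form $f$; if $f=0$ its multiplicity at every point is taken to be infinite. *)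

(* Defs.v *)
From mathcomp Require Import all_boot all_order all_algebra.
From mathcomp Require Import boolp.
From mathcomp Require Export mpoly.

Set Implicit Arguments.
Unset Strict Implicit.
Unset Printing Implicit Defensive.

Import GRing.Theory.
Local Open Scope ring_scope.

(* V_n, with x = 'X_0 and y = 'X_1. *)
Notation binform k n := (dhomog 2 k n).

Section Action.
Variable k : fieldType.

(* Substitution x |-> g00 x + g01 y, y |-> g10 x + g11 y, that is,
   f |-> f o g.  This is a right action; composing with g |-> g^-1 to get a
   left action does not change the invariants. *)
Definition linsubst (g : 'M[k]_2) : 2.-tuple {mpoly k[2]} :=
  [tuple \sum_(j < 2) g i j *: 'X_j | i < 2].

Lemma linsubst_homog n (g : 'M[k]_2) (f : binform k n) :
  (f : {mpoly k[2]}) \mPo linsubst g \is n.-homog.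
Proof.
rewrite comp_mpolyE big_seq rpred_sum // => m m_f; apply: rpredZ.
have /dhomogP/(_ m m_f) /= <- := dhomog_is_dhomog f.
rewrite mdegE; pose dt := [tuple m i | i < 2].
pose mt := [tuple tnth (linsubst g) i ^+ m i | i < 2].
have := @dhomog_prod _ _ mdeg _ dt mt.
rewrite !big_tuple.
rewrite (eq_bigr (fun i => tnth (linsubst g) i ^+ m i)); last first.
  by move=> i _; rewrite tnth_mktuple.
rewrite [X in _ \is X.-homog](eq_bigr m); last first.
  by move=> i _; rewrite tnth_mktuple.
apply=> i; rewrite !tnth_mktuple -[X in X.-homog]mul1n.
apply: dhomogMn; apply: rpred_sum => j _; apply: rpredZ.
by rewrite dhomogX /= mdeg1.
Qed.

Definition act n (g : 'M[k]_2) (f : binform k n) : binform k n :=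
  DHomog (linsubst_homog g f).

Definition act53 (g : 'M[k]_2) (v : binform k 5 * binform k 3) :
    binform k 5 * binform k 3 :=
  (act g v.1, act g v.2).

End Action.

Section NullCone.
Variable k : fieldType.

(* The coefficient of x^(n - j) y^j. *)
Definition bincoef n (f : binform k n) (j : nat) : k :=
  (f : {mpoly k[2]})@_(U_(ord0) *+ (n - j) + U_(ord_max) *+ j).

(* Linear coordinates on V_5 (+) V_3: six coefficients of F, four of G.
   They identify k[V_5 (+) V_3] with {mpoly k[6 + 4]}. *)
Definition coords53 (v : binform k 5 * binform k 3) (i : 'I_(6 + 4)) : k :=
  match split i with
  | inl j => bincoef v.1 j
  | inr j => bincoef v.2 j
  end.

(* Comparing values at points amounts to comparing elements of the coordinate
   ring because an algebraically closed field is infinite. *)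
Definition sl2_invariant (P : {mpoly k[6 + 4]}) : Prop :=
  forall g : 'M[k]_2, \det g = 1 ->
  forall v, P.@[coords53 (act53 g v)] = P.@[coords53 v].

Definition nullcone53 (v : binform k 5 * binform k 3) : Prop :=
  forall (d : nat) (P : {mpoly k[6 + 4]}),
    (0 < d)%N -> P \is d.-homog -> sl2_invariant P -> P.@[coords53 v] = 0.

End NullCone.

Section Multiplicity.
Variable k : fieldType.

(* A linear form whose only zero on P^1 is p = [p_0 : p_1]; a point of P^1 is
   given by a nonzero vector of homogeneous coordinates. *)
Definition ptform (p : 'rV[k]_2) : {mpoly k[2]} :=
  p 0 ord_max *: 'X_ord0 - p 0 ord0 *: 'X_ord_max.

Definition vanishes (p : 'rV[k]_2) (e : nat) (f : {mpoly k[2]}) : Prop :=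
  exists h : {mpoly k[2]}, f = ptform p ^+ e * h.

(* None stands for infinity.  For f != 0 and p != 0, no exponent e with
   vanishes p e f exceeds the degree (msize f).-1 (vanishes_lt_msize), and
   the value depends on p only up to scaling (mult_scale). *)
Definition mult (p : 'rV[k]_2) (f : {mpoly k[2]}) : option nat :=
  if f == 0 then None
  else Some (\max_(e < msize f | `[< vanishes p e f >]) e)%N.

Definition mult_ge (p : 'rV[k]_2) (f : {mpoly k[2]}) (m : nat) : bool :=
  if mult p f is Some e then (m <= e)%N else true.

Lemma ptform_neq0 (p : 'rV[k]_2) : p != 0 -> ptform p != 0.
Proof.
apply: contra => /eqP p0; apply/eqP/rowP => i; rewrite mxE.
have c0 := congr1 (mcoeff U_(ord0)) p0.
have c1 := congr1 (mcoeff U_(ord_max)) p0.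
move: c0 c1; rewrite !mcoeffB !mcoeffZ !mcoeffXU !mcoeff0 /=.
rewrite !(eqxx, mulr0, mulr1, subr0, sub0r) => q1 /eqP; rewrite oppr_eq0 => /eqP q0.
case: i => [[|[|//]] i_lt].
- by rewrite -[RHS]q0; congr (p 0 _); apply: val_inj.
- by rewrite -[RHS]q1; congr (p 0 _); apply: val_inj.
Qed.

Lemma vanishes_lt_msize (p : 'rV[k]_2) e (f : {mpoly k[2]}) :
  p != 0 -> f != 0 -> vanishes p e f -> (e < msize f)%N.
Proof.
move=> /ptform_neq0 p0 f0 [h fE].
have h0 : h != 0 by apply: contraNneq f0 => h0; rewrite fE h0 mulr0.
have l1 : ptform p \is 1.-homog.
  by rewrite rpredB // rpredZ // dhomogX /= mdeg1.
have le0 : ptform p ^+ e != 0 by rewrite expf_neq0.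
have sz : msize (ptform p ^+ e) = e.+1.
  have := dhomogMn e l1; rewrite mul1n => hom.
  have := dhomog_uniq le0 hom (dhomog_msize hom).
  by case: mmeasure (mmeasure_poly_eq0 mdeg (ptform p ^+ e)) => [|s _ -> //];
     rewrite eqxx (negbTE le0).
rewrite fE msizeM // sz addSn /=.
by rewrite -[X in (X < _)%N]addn0 ltn_add2l lt0n msize_poly_eq0.
Qed.

Lemma vanishes_le (p : 'rV[k]_2) e1 e2 (f : {mpoly k[2]}) :
  (e1 <= e2)%N -> vanishes p e2 f -> vanishes p e1 f.
Proof.
move=> le12 [h ->]; exists (ptform p ^+ (e2 - e1) * h).
by rewrite mulrA -exprD subnKC.
Qed.

Lemma mult_geP (p : 'rV[k]_2) (f : {mpoly k[2]}) m :
  p != 0 -> mult_ge p f m <-> vanishes p m f.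
Proof.
move=> p0; rewrite /mult_ge /mult; case: eqVneq => [->|f0].
  by split=> // _; exists 0; rewrite mulr0.
split=> [le_m|van]; last first.
  have lt_m := vanishes_lt_msize p0 f0 van.
  by apply: (@leq_bigmax_cond _ _ _ (Ordinal lt_m)); apply/asboolP.
apply: vanishes_le le_m _.
apply: (big_ind (fun e => vanishes p e f)).
- by exists f; rewrite mul1r.
- by move=> a b va vb; rewrite /maxn; case: ifP.
- by move=> e /asboolP.
Qed.

Lemma mult_scale (p : 'rV[k]_2) (c : k) (f : {mpoly k[2]}) :
  c != 0 -> mult (c *: p) f = mult p f.
Proof.
move=> c0; rewrite /mult; case: eqP => // _; congr Some.
apply: eq_bigl => e; apply: asbool_equiv_eq.
have lE : ptform (c *: p) = c *: ptform p.
  by rewrite /ptform !mxE scalerBr !scalerA.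
rewrite /vanishes lE exprZn; split=> -[h fE].
  by exists (c ^+ e *: h); rewrite {1}fE -scalerAl -scalerAr.
exists (c ^- e *: h); rewrite {1}fE.
by rewrite -scalerAl -scalerAr scalerA divff ?expf_neq0 // scale1r.
Qed.

End Multiplicity.

(* Main.v *)
(* A form of degree n is handled through its normalized coefficients a_j, where
   f = sum_j C(n, j) a_j x^(n-j) y^j.  For a point p = g(0 : 1) with det g = 1,
   mult_p(f) >= e means that the last e coefficients of f o g vanish.

   If such a p exists, the torus diag(t, 1/t) multiplies all nonzero coordinates
   of (F, G) o g by positive powers of t, so an invariant, being constant along
   the orbit, takes its value at the origin.

   Conversely ten invariants built from transvectants suffice.  With
   i = (F,F)_4, j = (F,i)_2 and t = (j,j)_2, the three invariants disc(i),
   (i,t)_2 and disc(t) vanish only if F has a triple root: move the double root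
   of i to x^2; if i <> 0 the remaining equations force a3 = a4 = a5 = 0, since
   a5 <> 0 would make F a fifth power and hence i = 0; if i = 0 then F = l^4 m
   with l and m linear, as a computation with a root of F at (0 : 1) shows.
   When a3 = a4 = a5 = 0 and F <> 0, invariants mixing F and G force
   b2 = b3 = 0.  When F = 0, the discriminant of G gives the double root. *)
Require Import Defs.
From HB Require Import structures.
From mathcomp Require Import all_boot all_order all_algebra ring.

Set Implicit Arguments.
Unset Strict Implicit.
Unset Printing Implicit Defensive.

Import GRing.Theory.
Local Open Scope ring_scope.

(** * Transvectants on normalized coefficients and their equivariance *)

Section Covariants.
Variable R : comNzRingType.
Implicit Types a b c : nat -> R.

(* [contr2] and [contr3] are the transvectants of order 2 and 3 of a form with a
   quadratic, resp. cubic, form; [hess] and [quad5] are 2 (b,b)_2 for a cubic and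
   2 (a,a)_4 for a quintic; [eval2 a b] evaluates the quadratic form a at the
   zero of the linear form b.  All act on normalized coefficients. *)
Definition contr2 a b p := a p * b 2%N - 2 * (a p.+1 * b 1%N) + a p.+2 * b 0%N.

Definition contr3 a b p :=
  a p * b 3%N - 3 * (a p.+1 * b 2%N) + 3 * (a p.+2 * b 1%N) - a p.+3 * b 0%N.

Definition hess a p :=
  [:: 2 * (a 0%N * a 2%N - a 1%N ^+ 2); a 0%N * a 3%N - a 1%N * a 2%N;
      2 * (a 1%N * a 3%N - a 2%N ^+ 2)]`_p.

Definition quad5 a p :=
  [:: 2 * (a 0%N * a 4%N - 4 * (a 1%N * a 3%N) + 3 * a 2%N ^+ 2);
      a 0%N * a 5%N - 3 * (a 1%N * a 4%N) + 2 * (a 2%N * a 3%N);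
      2 * (a 1%N * a 5%N - 4 * (a 2%N * a 4%N) + 3 * a 3%N ^+ 2)]`_p.

Definition eval2 a b :=
  a 0%N * b 1%N ^+ 2 - 2 * (a 1%N * b 0%N * b 1%N) + a 2%N * b 0%N ^+ 2.

Section Substitution.
Variables s t u v : R.

Definition polar x y a j := x * a j + y * a j.+1.

(* Normalized coefficients of f(s x + t y, u x + v y): the m-th one polarizes f
   at n - m copies of (s, u) and m copies of (t, v). *)
Definition subst_coef n a m := iter (n - m) (polar s u) (iter m (polar t v) a) 0%N.

Definition transf n a a' := forall m, (m <= n)%N -> a' m = subst_coef n a m.

Hypothesis det1 : s * v - t * u = 1.

(** Equivariance carries a power of the determinant equal to the order of the transvectant.
    Inserting that power makes each identity below valid for arbitrary [s t u v], so that [ring]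
    applies. *)
Lemma mul_detX r x : x = (s * v - t * u) ^+ r * x.
Proof. by rewrite det1 expr1n mul1r. Qed.

Lemma transf_quad5 a a' : transf 5 a a' -> transf 2 (quad5 a) (quad5 a').
Proof.
by move=> ha [|[|[|//]]] _; rewrite [RHS](mul_detX 4) /quad5 /= !ha //;
   rewrite /subst_coef /= /polar /=; ring.
Qed.

Lemma transf_hess a a' : transf 3 a a' -> transf 2 (hess a) (hess a').
Proof.
by move=> ha [|[|[|//]]] _; rewrite [RHS](mul_detX 2) /hess /= !ha //;
   rewrite /subst_coef /= /polar /=; ring.
Qed.

Lemma transf_contr2_5 a a' b b' :
  transf 5 a a' -> transf 2 b b' -> transf 3 (contr2 a b) (contr2 a' b').
Proof.
by move=> ha hb [|[|[|[|//]]]] _; rewrite [RHS](mul_detX 2) /contr2 !ha ?hb //;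
   rewrite /subst_coef /= /polar /=; ring.
Qed.

Lemma transf_contr2_3 a a' b b' :
  transf 3 a a' -> transf 2 b b' -> transf 1 (contr2 a b) (contr2 a' b').
Proof.
by move=> ha hb [|[|//]] _; rewrite [RHS](mul_detX 2) /contr2 !ha ?hb //;
   rewrite /subst_coef /= /polar /=; ring.
Qed.

Lemma transf_contr3_5 a a' b b' :
  transf 5 a a' -> transf 3 b b' -> transf 2 (contr3 a b) (contr3 a' b').
Proof.
by move=> ha hb [|[|[|//]]] _; rewrite [RHS](mul_detX 3) /contr3 !ha ?hb //;
   rewrite /subst_coef /= /polar /=; ring.
Qed.

Lemma contr2_inv a a' b b' :
  transf 2 a a' -> transf 2 b b' -> contr2 a' b' 0%N = contr2 a b 0%N.
Proof.
by move=> ha hb; rewrite [RHS](mul_detX 2) /contr2 !ha ?hb //;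
   rewrite /subst_coef /= /polar /=; ring.
Qed.

Lemma contr3_inv a a' b b' :
  transf 3 a a' -> transf 3 b b' -> contr3 a' b' 0%N = contr3 a b 0%N.
Proof.
by move=> ha hb; rewrite [RHS](mul_detX 3) /contr3 !ha ?hb //;
   rewrite /subst_coef /= /polar /=; ring.
Qed.

Lemma eval2_inv a a' b b' :
  transf 2 a a' -> transf 1 b b' -> eval2 a' b' = eval2 a b.
Proof.
by move=> ha hb; rewrite [RHS](mul_detX 2) /eval2 !ha ?hb //;
   rewrite /subst_coef /= /polar /=; ring.
Qed.

End Substitution.
End Covariants.

(** * Umbral calculus: the coefficient formula for linear substitutions *)

Section Umbral.
Variable R : comNzRingType.
Implicit Types (a : nat -> R) (p q : {poly R}).

(* The linear functional sending 'X^j to [a j], so that a form f of degree n is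
   [umbral a ((x + y X) ^+ n)]. *)
Definition umbral a p := \sum_(i < size p) p`_i * a i.

Lemma umbral_widen a p n : (size p <= n)%N -> umbral a p = \sum_(i < n) p`_i * a i.
Proof.
move=> le_n; rewrite /umbral (big_ord_widen n (fun i => p`_i * a i)) // big_mkcond.
by apply: eq_bigr => i _; case: ltnP => // le_i; rewrite nth_default ?mul0r.
Qed.

Lemma umbral_is_linear a : scalar (umbral a).
Proof.
move=> c p q; pose n := maxn (size p) (size q).
rewrite (@umbral_widen _ p n) ?leq_maxl // (@umbral_widen _ q n) ?leq_maxr //.
rewrite (@umbral_widen _ _ n); last first.
  rewrite (leq_trans (size_polyD _ _)) // geq_max leq_maxr andbT.
  by rewrite (leq_trans (size_scale_leq _ _)) ?leq_maxl.
rewrite mulr_sumr -big_split; apply: eq_bigr => i _.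
by rewrite coefD coefZ mulrDl mulrA.
Qed.

HB.instance Definition _ a :=
  GRing.isLinear.Build R {poly R} R *%R (umbral a) (umbral_is_linear a).

Lemma umbralXn a j : umbral a 'X^j = a j.
Proof.
rewrite /umbral size_polyXn (bigD1 ord_max) //= big1 ?addr0 => [|i ne_i].
  by rewrite coefXn eqxx mul1r.
rewrite coefXn; case: eqP => [e|]; last by rewrite mul0r.
by case/eqP: ne_i; apply: val_inj.
Qed.

(** Polarization is adjoint to multiplication by [x + y X], so iterated polarizations turn into
    commuting polynomial factors. *)
Lemma umbral_polar x y a p :
  umbral (polar x y a) p = umbral a ((x%:P + y *: 'X) * p).
Proof.
rewrite -[p in RHS]coefK poly_def mulr_sumr linear_sum /= [LHS]/umbral.
apply: eq_bigr => i _; rewrite mulrDl mul_polyC -scalerAl -scalerAr -exprS.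
by rewrite linearD !linearZ /= !umbralXn /polar; ring.
Qed.

Lemma umbral_iter n x y a p :
  umbral (iter n (polar x y) a) p = umbral a ((x%:P + y *: 'X) ^+ n * p).
Proof.
elim: n p => [|n IHn] p; first by rewrite mul1r.
by rewrite umbral_polar IHn mulrA exprSr.
Qed.

Lemma subst_coefE s t u v n a m :
  subst_coef s t u v n a m =
  umbral a ((s%:P + u *: 'X) ^+ (n - m) * (t%:P + v *: 'X) ^+ m).
Proof.
by rewrite mulrC -umbral_iter -[_ ^+ (n - m)]mulr1 -umbral_iter -(expr0 'X) umbralXn.
Qed.

(** Both sides expand [umbral a] of the same n-th power, whose linear base is grouped either by
    powers of [X] or by [x] and [y]. *)
Lemma subst_form s t u v n a x y :
  \sum_(j < n.+1) 'C(n, j)%:R * a j *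
    ((s * x + t * y) ^+ (n - j) * (u * x + v * y) ^+ j) =
  \sum_(j < n.+1) 'C(n, j)%:R * subst_coef s t u v n a j *
    (x ^+ (n - j) * y ^+ j).
Proof.
transitivity (umbral a (((s * x + t * y)%:P + (u * x + v * y) *: 'X) ^+ n)).
  rewrite exprDn linear_sum; apply: eq_bigr => j _ /=.
  rewrite raddfMn /= exprZn -polyC_exp mul_polyC scalerA linearZ /= umbralXn.
  ring.
have -> : (s * x + t * y)%:P + (u * x + v * y) *: 'X =
    x *: (s%:P + u *: 'X) + y *: (t%:P + v *: 'X) :> {poly R}.
  by rewrite -!mul_polyC !polyCD !polyCM; ring.
rewrite exprDn linear_sum; apply: eq_bigr => j _ /=.
rewrite raddfMn /= !exprZn -scalerAl -scalerAr scalerA linearZ /= subst_coefE.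
ring.
Qed.

End Umbral.

Lemma rmorph_iter_polar (R S : comNzRingType) (f : {rmorphism R -> S}) x y a b n :
  (forall j, b j = f (a j)) ->
  forall j, iter n (polar (f x) (f y)) b j = f (iter n (polar x y) a j).
Proof. by move=> ab; elim: n => //= n IHn j; rewrite /polar !IHn rmorphD !rmorphM. Qed.

(** Serves to apply [subst_form] over [{mpoly k[2]}], with scalars embedded as constants and x, y
    the variables. *)
Lemma rmorph_subst_coef (R S : comNzRingType) (f : {rmorphism R -> S}) s t u v n a m :
  f (subst_coef s t u v n a m) =
  subst_coef (f s) (f t) (f u) (f v) n (fun j => f (a j)) m.
Proof. by apply/esym/rmorph_iter_polar => j; apply: rmorph_iter_polar. Qed.

Lemma lift00_max : lift ord0 ord0 = ord_max :> 'I_2.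
Proof. exact: val_inj. Qed.

Notation transf_mx g :=
  (transf (g ord0 ord0) (g ord0 ord_max) (g ord_max ord0) (g ord_max ord_max)).

(** * Binary forms, their normalized coefficients and the action on them *)

Section Forms.
Variable k : fieldType.
Hypothesis hk : [pchar k] =i pred0.

Local Notation X := ('X_ord0 : {mpoly k[2]}).
Local Notation Y := ('X_ord_max : {mpoly k[2]}).

Definition mon n j : 'X_{1..2} := (U_(ord0) *+ (n - j) + U_(ord_max) *+ j)%MM.

Lemma mon_eq n i j : (mon n i == mon n j) = (i == j).
Proof.
apply/eqP/eqP => [/(congr1 (fun m : 'X_{1..2} => m ord_max))|-> //].
by rewrite /mon !mnmE /= !mulmnE !mnm1E /= !mul0n !mul1n.
Qed.

Lemma mdeg_mon n j : (j <= n)%N -> mdeg (mon n j) = n.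
Proof. by move=> le_jn; rewrite mdegD !mdegMn !mdeg1 !mul1n subnK. Qed.

Lemma mon_mdeg (m : 'X_{1..2}) : m = mon (mdeg m) (m ord_max).
Proof.
apply/mnmP => i; rewrite mnmDE !mulmnE !mnm1E mdegE big_ord_recl big_ord1.
case: i => [[|[|//]] lt_i] /=; rewrite ?mul1n ?mul0n ?addn0 ?add0n.
  by rewrite lift00_max addnK; congr (m _); apply: val_inj.
by congr (m _); apply: val_inj.
Qed.

Lemma binformE n (f : binform k n) :
  (f : {mpoly k[2]}) =
    \sum_(j < n.+1) bincoef f j *: (X ^+ (n - j) * Y ^+ j).
Proof.
have hom := dhomog_is_dhomog f.
apply/mpolyP => m; rewrite raddf_sum /=.
under eq_bigr => j _ do rewrite mcoeffZ !mpolyXn -mpolyXD mcoeffX.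
have [dm|dm] := eqVneq (mdeg m) n; last first.
  rewrite (dhomog_nemf_coeff hom) // big1 // => j _.
  case: eqP => [e|]; last by rewrite mulr0.
  by move: dm; rewrite -e (@mdeg_mon n j) ?eqxx // -ltnS.
have le_m : (m ord_max < n.+1)%N.
  by rewrite ltnS -dm mdegE big_ord_recl big_ord1 lift00_max leq_addl.
rewrite (bigD1 (Ordinal le_m)) //= big1 => [|j ne_j].
  by rewrite addr0 {1}[m]mon_mdeg dm [X in (_ == X)]mon_mdeg dm eqxx mulr1.
case: eqP => [e|]; last by rewrite mulr0.
by case/eqP: ne_j; apply: val_inj; rewrite /= -e mnmDE !mulmnE !mnm1E /= mul0n mul1n.
Qed.

Lemma bincoef_sum n (f : binform k n) (c : nat -> k) :
  (f : {mpoly k[2]}) =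
    \sum_(j < n.+1) c j *: (X ^+ (n - j) * Y ^+ j) ->
  forall j, (j <= n)%N -> bincoef f j = c j.
Proof.
rewrite /bincoef => -> j le_j; rewrite raddf_sum /=.
under eq_bigr => i _ do rewrite mcoeffZ !mpolyXn -mpolyXD mcoeffX.
rewrite -ltnS in le_j.
rewrite (bigD1 (Ordinal le_j)) //= big1 ?addr0 ?eqxx ?mulr1 // => i ne_i.
rewrite -(inj_eq val_inj) /= in ne_i.
by rewrite -/(mon n i) -/(mon n j) mon_eq (negbTE ne_i) mulr0.
Qed.

Definition ncoef n (f : binform k n) j := bincoef f j / 'C(n, j)%:R.

Lemma natr_neq0 n : (0 < n)%N -> n%:R != 0 :> k.
Proof. by rewrite ((pcharf0P _).1 hk) lt0n. Qed.

Lemma ncoefE n (f : binform k n) j :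
  (j <= n)%N -> bincoef f j = 'C(n, j)%:R * ncoef f j.
Proof. by move=> le_j; rewrite mulrC divfK // natr_neq0 // bin_gt0. Qed.

Lemma linsubstE (g : 'M[k]_2) i :
  tnth (linsubst g) i = g i ord0 *: X + g i ord_max *: Y.
Proof. by rewrite tnth_mktuple big_ord_recl big_ord1 lift00_max. Qed.

Lemma comp_linsubstX (g : 'M[k]_2) i :
  'X_i \mPo linsubst g = g i ord0 *: X + g i ord_max *: Y.
Proof. by rewrite comp_mpolyXU -tnth_nth linsubstE. Qed.

Lemma comp_form (g : 'M[k]_2) c i j :
  (c *: (X ^+ i * Y ^+ j)) \mPo linsubst g =
  c%:MP * (((g ord0 ord0)%:MP * X + (g ord0 ord_max)%:MP * Y) ^+ i *
   ((g ord_max ord0)%:MP * X + (g ord_max ord_max)%:MP * Y) ^+ j).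
Proof.
by rewrite comp_mpolyZ rmorphM 2!rmorphXn /= !comp_linsubstX -!mul_mpolyC.
Qed.

Lemma comp_binform n (g : 'M[k]_2) (f : binform k n) :
  (f : {mpoly k[2]}) \mPo linsubst g = \sum_(j < n.+1) (bincoef f j)%:MP *
    (((g ord0 ord0)%:MP * X + (g ord0 ord_max)%:MP * Y) ^+ (n - j) *
     ((g ord_max ord0)%:MP * X + (g ord_max ord_max)%:MP * Y) ^+ j).
Proof.
rewrite {1}binformE (raddf_sum (comp_mpoly (linsubst g))) /=.
by apply: eq_bigr => j _; apply: comp_form.
Qed.

Lemma transf_ncoef n (g : 'M[k]_2) (f : binform k n) :
  transf_mx g n (ncoef f) (ncoef (act g f)).
Proof.
move=> m le_m; set t := subst_coef _ _ _ _ _ _.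
rewrite /ncoef (@bincoef_sum _ _ (fun j => 'C(n, j)%:R * t j)) //; last first.
  rewrite /= comp_binform.
  have E (j : 'I_n.+1) :
      (bincoef f j)%:MP = 'C(n, j)%:R * (ncoef f j)%:MP :> {mpoly k[2]}.
    by rewrite (ncoefE f (ltn_ord j : (j <= n)%N)) mpolyCM mpolyC_nat.
  under [LHS]eq_bigr => j _ do rewrite E.
  rewrite (subst_form _ _ _ _ _ (fun j => (ncoef f j)%:MP)).
  apply: eq_bigr => j _.
  by rewrite -rmorph_subst_coef -mul_mpolyC mpolyCM mpolyC_nat.
by rewrite mulrAC divff ?mul1r // natr_neq0 // bin_gt0.
Qed.

Lemma mulmx2E (g h : 'M[k]_2) i l :
  (g *m h) i l = g i ord0 * h ord0 l + g i ord_max * h ord_max l.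
Proof. by rewrite mxE big_ord_recl big_ord1 lift00_max. Qed.

Lemma comp_row (g h : 'M[k]_2) i :
  ((g i ord0)%:MP * X + (g i ord_max)%:MP * Y) \mPo linsubst h =
  ((g *m h) i ord0)%:MP * X + ((g *m h) i ord_max)%:MP * Y.
Proof.
rewrite comp_mpolyD 2!rmorphM /= !comp_mpolyC !comp_linsubstX.
by rewrite -!mul_mpolyC !mulmx2E !mpolyCD !mpolyCM; ring.
Qed.

Lemma act_comp n (g h : 'M[k]_2) (f : binform k n) :
  act h (act g f) = act (g *m h) f.
Proof.
apply: val_inj; rewrite /= !comp_binform (raddf_sum (comp_mpoly (linsubst h))) /=.
apply: eq_bigr => j _; rewrite 2!rmorphM 2!rmorphXn /= comp_mpolyC.
by rewrite !comp_row.
Qed.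

Lemma act1 n (f : binform k n) : act 1%:M f = f.
Proof.
apply: val_inj => /=; rewrite -[RHS]comp_mpoly_id; congr comp_mpoly.
apply: eq_from_tnth => i; rewrite linsubstE tnth_mktuple !mxE.
case: i => [[|[|//]] lt_i]; rewrite /= !(scale1r, scale0r, add0r, addr0);
by congr 'X_ _; apply: val_inj.
Qed.

Lemma act_inj n (g : 'M[k]_2) (f : binform k n) : \det g = 1 ->
  act (\adj g) (act g f) = f.
Proof. by move=> dg; rewrite act_comp mul_mx_adj dg act1. Qed.

Lemma act0 n (g : 'M[k]_2) : act g (0 : binform k n) = 0.
Proof. by apply: val_inj; rewrite /= raddf0. Qed.

End Forms.

(** * Points of the projective line and vanishing orders *)

Section Point.
Variable k : fieldType.
Hypothesis hk : [pchar k] =i pred0.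
Local Notation X := ('X_ord0 : {mpoly k[2]}).
Local Notation Y := ('X_ord_max : {mpoly k[2]}).

Lemma det2E (g : 'M[k]_2) :
  \det g = g ord0 ord0 * g ord_max ord_max - g ord0 ord_max * g ord_max ord0.
Proof.
rewrite -lift00_max.
rewrite (expand_det_row _ ord0) big_ord_recl big_ord1 /cofactor !det_mx11 !mxE /=.
have -> : lift (lift ord0 ord0) ord0 = ord0 :> 'I_2 by apply: val_inj.
by rewrite expr0 expr1 mul1r mulN1r mulrN.
Qed.

Definition mx2 (s t u v : k) : 'M[k]_2 :=
  \matrix_(i, j) (if i == ord0 then if j == ord0 then s else t
                  else if j == ord0 then u else v).

Lemma det_mx2 s t u v : \det (mx2 s t u v) = s * v - t * u.
Proof. by rewrite det2E !mxE. Qed.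

(* The point g(0 : 1). *)
Definition col2 (g : 'M[k]_2) : 'rV[k]_2 := \row_j g j ord_max.

Lemma ptform_homog (p : 'rV[k]_2) : ptform p \is 1.-homog.
Proof. by rewrite rpredB // rpredZ // dhomogX /= mdeg1. Qed.

(** The pullback of a linear form vanishing at g(0 : 1) vanishes at (0 : 1), hence is a multiple of
    x; the factor is the determinant. *)
Lemma ptform_comp (g : 'M[k]_2) :
  \det g = 1 -> ptform (col2 g) \mPo linsubst g = X.
Proof.
rewrite det2E => dg; rewrite comp_mpolyB !comp_mpolyZ !comp_linsubstX !mxE.
rewrite -[RHS]scale1r -dg -!mul_mpolyC mpolyCB !mpolyCM; ring.
Qed.

Lemma X_comp (g : 'M[k]_2) :
  \det g = 1 -> X \mPo linsubst (\adj g) = ptform (col2 g).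
Proof.
move=> dg; have := congr1 val (act_inj (DHomog (ptform_homog (col2 g))) dg).
by rewrite /= ptform_comp.
Qed.

Lemma mcoeff_Xmul e (q : {mpoly k[2]}) (m : 'X_{1..2}) :
  (m ord0 < e)%N -> (X ^+ e * q)@_m = 0.
Proof.
move=> lt_e; apply/eqP; rewrite mcoeff_eq0; apply/negP => /msuppM_le/allpairsP[[m1 m2]] /=.
rewrite mpolyXn msuppX inE => -[/eqP m1E _ mE].
by move: lt_e; rewrite mE m1E mnmDE mulmnE mnm1E /= mul1n ltnNge leq_addr.
Qed.

(** Substituting [g] turns the linear form of the point into x, and divisibility by x^e means that
    the coefficients of x^(n - j) y^j with n - j < e vanish. *)
Lemma vanishesP n (f : binform k n) (g : 'M[k]_2) e : \det g = 1 -> (e <= n)%N ->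
  vanishes (col2 g) e f <->
  (forall j, (n - e < j <= n)%N -> ncoef (act g f) j = 0).
Proof.
move=> dg le_en; split=> [[h fE] j /andP[lt_j le_j]|h0].
  rewrite /ncoef /bincoef /= fE rmorphM rmorphXn /= ptform_comp //.
  rewrite mcoeff_Xmul ?mul0r // mnmDE !mulmnE !mnm1E /= mul1n mul0n addn0.
  by rewrite ltn_subCl.
(* The cofactor is the quotient of [act g f] by x^e, carried back by the inverse substitution; the
   bound on [j] keeps the truncated exponent [n - j - e] exact. *)
exists ((\sum_(j < n.+1 | (j <= n - e)%N)
            bincoef (act g f) j *: (X ^+ (n - j - e) * Y ^+ j))
         \mPo linsubst (\adj g)).
rewrite -{1}(act_inj f dg) -X_comp // -rmorphXn -rmorphM /=; congr (_ \mPo _).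
rewrite -[LHS]/(val (act g f)) [LHS]binformE mulr_sumr [RHS]big_mkcond /=.
apply: eq_bigr => j _.
case: ifPn => [le_j|]; last first.
  rewrite -ltnNge => lt_j; have le_j : (j <= n)%N by rewrite -ltnS.
  by rewrite (ncoefE hk (act g f) le_j) h0 ?mulr0 ?scale0r // lt_j.
by rewrite -scalerAr mulrA -exprD subnKC // leq_subCr // -ltnS.
Qed.

End Point.

(** * The ten invariants *)

(** With h = (G,G)_2 and q = (F,G)_3, these are, up to constants: disc(i), (i,t)_2, disc(t),
    disc(G), (i,h)_2, (j,G)_3, disc(q), q at the zero of (G,q)_2, (q,h)_2, and h at the zero of
    ((F,h)_2,h)_2. *)
Definition invariants (R : comNzRingType) (a b : nat -> R) : seq R :=
  let i := quad5 a in
  let h := hess b in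
  let j := contr2 a i in
  let t := hess j in
  let q := contr3 a b in
  [:: contr2 i i 0%N; contr2 i t 0%N; contr2 t t 0%N;
      contr2 h h 0%N; contr2 i h 0%N; contr3 j b 0%N; contr2 q q 0%N;
      eval2 q (contr2 b q); contr2 q h 0%N; eval2 h (contr2 (contr2 a h) h)].

Definition invariant_degrees := [:: 4; 8; 12; 4; 4; 4; 4; 8; 4; 12]%N.

Lemma invariants_transf (R : comNzRingType) (s t u v : R) a a' b b' :
  s * v - t * u = 1 -> transf s t u v 5 a a' -> transf s t u v 3 b b' ->
  invariants a' b' = invariants a b.
Proof.
move=> det1 ha hb.
have hi := transf_quad5 det1 ha; have hh := transf_hess det1 hb.
have hj := transf_contr2_5 det1 ha hi; have ht := transf_hess det1 hj.
have hq := transf_contr3_5 det1 ha hb; have hl := transf_contr2_3 det1 hb hq.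
have hm := transf_contr2_3 det1 (transf_contr2_5 det1 ha hh) hh.
rewrite /invariants; congr [:: _; _; _; _; _; _; _; _; _; _].
all: by [apply: (contr2_inv det1)|apply: (contr3_inv det1)|apply: (eval2_inv det1)].
Qed.

(** * Compatibility of the invariants with ring morphisms *)

Section Morphism.
Variables (R S : comNzRingType) (f : {rmorphism R -> S}).

Ltac rmorph_tac :=
  by rewrite ?nth_nil !(rmorph_nat, rmorph0, rmorphXn, rmorphM, rmorphB, rmorphD).

Lemma rmorph_contr2 (a b : nat -> R) (a' b' : nat -> S) :
  a' =1 f \o a -> b' =1 f \o b -> contr2 a' b' =1 f \o contr2 a b.
Proof. by move=> ha hb p; rewrite /contr2 /= !ha !hb; rmorph_tac. Qed.

Lemma rmorph_contr3 (a b : nat -> R) (a' b' : nat -> S) :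
  a' =1 f \o a -> b' =1 f \o b -> contr3 a' b' =1 f \o contr3 a b.
Proof. by move=> ha hb p; rewrite /contr3 /= !ha !hb; rmorph_tac. Qed.

Lemma rmorph_hess (a : nat -> R) (a' : nat -> S) :
  a' =1 f \o a -> hess a' =1 f \o hess a.
Proof. by move=> ha [|[|[|p]]]; rewrite /hess /= ?ha; rmorph_tac. Qed.

Lemma rmorph_quad5 (a : nat -> R) (a' : nat -> S) :
  a' =1 f \o a -> quad5 a' =1 f \o quad5 a.
Proof. by move=> ha [|[|[|p]]]; rewrite /quad5 /= ?ha; rmorph_tac. Qed.

Lemma rmorph_eval2 (a b : nat -> R) (a' b' : nat -> S) :
  a' =1 f \o a -> b' =1 f \o b -> eval2 a' b' = f (eval2 a b).
Proof. by move=> ha hb; rewrite /eval2 /= !ha !hb; rmorph_tac. Qed.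

(** Allows the invariants to be formed once on the coordinate functions and then evaluated at
    points. *)
Lemma rmorph_invariants (a b : nat -> R) (a' b' : nat -> S) :
  a' =1 f \o a -> b' =1 f \o b -> invariants a' b' = map f (invariants a b).
Proof.
move=> ha hb; have hi := rmorph_quad5 ha; have hh := rmorph_hess hb.
have hj := rmorph_contr2 ha hi; have ht := rmorph_hess hj.
have hq := rmorph_contr3 ha hb; have hl := rmorph_contr2 hb hq.
have hm := rmorph_contr2 (rmorph_contr2 ha hh) hh.
rewrite /invariants /=; congr [:: _; _; _; _; _; _; _; _; _; _].
all: by [apply: rmorph_contr2|apply: rmorph_contr3|apply: rmorph_eval2].
Qed.

End Morphism.

(** * Homogeneity and degrees of the invariants *)

Section Homogeneous.
Variables (k : fieldType) (n : nat).
Implicit Types (a b : nat -> {mpoly k[n]}).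

Lemma homog_nat c d (p : {mpoly k[n]}) : p \is d.-homog -> c%:R * p \is d.-homog.
Proof. by move=> hp; rewrite mulr_natl rpredMn. Qed.

Ltac homog_tac := do ?[apply: rpredB | apply: rpredD | apply: homog_nat];
  rewrite ?expr2; do 2?apply: dhomogM.

Lemma homog_contr2 d e a b :
  (forall p, a p \is d.-homog) -> (forall p, b p \is e.-homog) ->
  forall p, contr2 a b p \is (d + e).-homog.
Proof. by move=> ha hb p; homog_tac. Qed.

Lemma homog_contr3 d e a b :
  (forall p, a p \is d.-homog) -> (forall p, b p \is e.-homog) ->
  forall p, contr3 a b p \is (d + e).-homog.
Proof. by move=> ha hb p; homog_tac. Qed.

Lemma homog_hess d a : (forall p, a p \is d.-homog) ->
  forall p, hess a p \is (d + d).-homog.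
Proof.
by move=> ha [|[|[|p]]]; rewrite /hess /= ?nth_nil ?rpred0 //; homog_tac.
Qed.

Lemma homog_quad5 d a : (forall p, a p \is d.-homog) ->
  forall p, quad5 a p \is (d + d).-homog.
Proof.
by move=> ha [|[|[|p]]]; rewrite /quad5 /= ?nth_nil ?rpred0 //; homog_tac.
Qed.

Lemma homog_eval2 d e a b :
  (forall p, a p \is d.-homog) -> (forall p, b p \is e.-homog) ->
  eval2 a b \is (d + (e + e)).-homog.
Proof. by move=> ha hb; rewrite /eval2 -mulrA; homog_tac. Qed.

Lemma homog_invariants a b :
  (forall p, a p \is 1.-homog) -> (forall p, b p \is 1.-homog) ->
  forall i, (i < 10)%N ->
  nth 0 (invariants a b) i \is (nth 0%N invariant_degrees i).-homog.
Proof.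
move=> ha hb; have hi := homog_quad5 ha; have hh := homog_hess hb.
have hj := homog_contr2 ha hi; have ht := homog_hess hj.
have hq := homog_contr3 ha hb; have hl := homog_contr2 hb hq.
have hm := homog_contr2 (homog_contr2 ha hh) hh.
do 10?[case=> [|]] => // _.
- exact: (homog_contr2 hi hi).
- exact: (homog_contr2 hi ht).
- exact: (homog_contr2 ht ht).
- exact: (homog_contr2 hh hh).
- exact: (homog_contr2 hi hh).
- exact: (homog_contr3 hj hb).
- exact: (homog_contr2 hq hq).
- exact: (homog_eval2 hq hl).
- exact: (homog_contr2 hq hh).
- exact: (homog_eval2 hh hm).
Qed.

End Homogeneous.

(** * Vanishing of the ten invariants on the null cone *)

Section NullInvariants.
Variable k : fieldType.
Hypothesis hk : [pchar k] =i pred0.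

(* Normalized coefficients as linear coordinate functions; out of range they
   are 0 because 'C(n, m) = 0 and 0^-1 = 0. *)
Definition coef5 m : {mpoly k[6 + 4]} :=
  'C(5, m)%:R^-1 *: 'X_(lshift 4 (inord m)).
Definition coef3 m : {mpoly k[6 + 4]} :=
  'C(3, m)%:R^-1 *: 'X_(rshift 6 (inord m)).

Lemma meval_coef5 (v : binform k 5 * binform k 3) m :
  (coef5 m).@[coords53 v] = ncoef v.1 m.
Proof.
rewrite mevalZ mevalXU /coords53 (unsplitK (inl _)) /ncoef mulrC.
have [le_m|lt_m] := leqP m 5; first by rewrite inordK.
by rewrite (bin_small lt_m) invr0 2!mulr0.
Qed.

Lemma meval_coef3 (v : binform k 5 * binform k 3) m :
  (coef3 m).@[coords53 v] = ncoef v.2 m.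
Proof.
rewrite mevalZ mevalXU /coords53 (unsplitK (inr _)) /ncoef mulrC.
have [le_m|lt_m] := leqP m 3; first by rewrite inordK.
by rewrite (bin_small lt_m) invr0 2!mulr0.
Qed.

Lemma invariants_act (g : 'M[k]_2) F G : \det g = 1 ->
  invariants (ncoef (act g F)) (ncoef (act g G)) =
  invariants (ncoef (F : binform k 5)) (ncoef (G : binform k 3)).
Proof.
by rewrite det2E => dg; apply: (invariants_transf dg); apply: transf_ncoef.
Qed.

Lemma nullcone_invariants (F : binform k 5) (G : binform k 3) :
  nullcone53 (F, G) -> invariants (ncoef F) (ncoef G) = nseq 10 0.
Proof.
move=> null; apply: (@eq_from_nth _ 0) => // i lt_i; rewrite nth_nseq [(i < _)%N]lt_i.
pose P := nth 0 (invariants coef5 coef3) i.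
have PE v : P.@[coords53 v] = nth 0 (invariants (ncoef v.1) (ncoef v.2)) i.
  rewrite (@rmorph_invariants _ _ (meval (coords53 v)) coef5 coef3).
  - by rewrite (nth_map 0).
  - by move=> m; rewrite /= meval_coef5.
  - by move=> m; rewrite /= meval_coef3.
rewrite -[LHS](PE (F, G)); apply: (null (nth 0%N invariant_degrees i)).
- by move: i lt_i {P PE}; do 10?case=> //.
- by apply: homog_invariants => // m; rewrite rpredZ // dhomogX /= mdeg1.
- by move=> g dg v; rewrite !PE invariants_act.
Qed.

End NullInvariants.

(** * Degeneration to the origin under the torus *)

Section Torus.
Variable k : closedFieldType.
Hypothesis hk : [pchar k] =i pred0.

(* Otherwise [(q - x) X + 1], which has no root, would be nonconstant. *)
Lemma poly_const (q : {poly k}) x : (forall t, t != 0 -> q.[t] = x) -> q = x%:P.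
Proof.
move=> qx; apply/eqP; rewrite -subr_eq0; apply/negPn/negP => nz.
pose r := (q - x%:P) * 'X + 1.
have /closed_rootP[t] : size r != 1%N.
  rewrite /r size_polyDl size_mulX // ?size_poly1 //.
    by rewrite eqSS size_poly_eq0.
  by rewrite ltnS lt0n size_poly_eq0.
rewrite /root /r hornerD hornerM hornerX hornerD hornerN !hornerC.
have [->|/qx ->] := eqVneq t 0; first by rewrite mulr0 add0r oner_eq0.
by rewrite subrr mul0r add0r oner_eq0.
Qed.

(** Along the curve, [P] is a polynomial in t that is constant off 0, hence constant. At t = 0 every
    coordinate is 0, by positive weight or by hypothesis, and [P] has no constant term. *)
Lemma meval_contract n (P : {mpoly k[n]}) d (c : 'I_n -> k) (w : 'I_n -> nat) x :
  (0 < d)%N -> P \is d.-homog -> (forall i, w i = 0%N -> c i = 0) ->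
  (forall t, t != 0 -> P.@[fun i => t ^+ w i * c i] = x) -> x = 0.
Proof.
move=> d_gt0 homP w0 Px; pose q := mmap (@polyC k) (fun i => 'X^(w i) * (c i)%:P) P.
have qE t : q.[t] = P.@[fun i => t ^+ w i * c i].
  rewrite /q /mmap horner_sum mevalE; apply: eq_bigr => m _.
  rewrite hornerM hornerC /mmap1 horner_prod; congr (_ * _); apply: eq_bigr => i _.
  by rewrite horner_exp hornerM hornerC hornerXn.
have /(congr1 (horner^~ 0)) := @poly_const q x (fun t t0 => etrans (qE t) (Px t t0)).
rewrite hornerC qE => <-.
rewrite (@meval_eq _ _ _ (fun=> 0)) => [|i]; last first.
  by case: (posnP (w i)) => [/w0 ->|w_gt0]; rewrite ?mulr0 // expr0n gtn_eqF ?mul0r.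
rewrite mevalE big_seq big1 // => m m_P; rewrite prodrXr -mdegE.
by rewrite (dhomog_mf homP m_P) expr0n gtn_eqF ?mulr0.
Qed.

Lemma iter_polarl x (a : nat -> k) n :
  iter n (polar x 0) a =1 (fun j => x ^+ n * a j).
Proof.
by elim: n => [|n IHn] j /=; rewrite ?mul1r // /polar !IHn mul0r addr0 exprS mulrA.
Qed.

Lemma iter_polarr y (a : nat -> k) n :
  iter n (polar 0 y) a =1 (fun j => y ^+ n * a (n + j)%N).
Proof.
by elim: n => [|n IHn] j /=; rewrite ?mul1r // /polar !IHn mul0r add0r exprS mulrA addnS.
Qed.

Lemma nullcone_act (g : 'M[k]_2) v : \det g = 1 ->
  nullcone53 (act53 g v) -> nullcone53 v.
Proof. by move=> dg null d P d_gt0 homP invP; rewrite -(invP g dg) (null d). Qed.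

Definition torus (t : k) := mx2 t 0 0 t^-1.

Lemma det_torus t : t != 0 -> \det (torus t) = 1.
Proof. by move=> t0; rewrite det_mx2 divff // mulr0 subr0. Qed.

(** The monomial x^(n - j) y^j has weight n - 2j. A negative weight is truncated to 0, which is
    harmless because the coefficient is then assumed to vanish. *)
Lemma bincoef_torus n (f : binform k n) j t : t != 0 -> (j <= n)%N ->
  (n < j.*2)%N ==> (bincoef f j == 0) ->
  bincoef (act (torus t) f) j = t ^+ (n - j.*2) * bincoef f j.
Proof.
move=> t0 le_j.
rewrite (ncoefE hk f le_j) (ncoefE hk (act (torus t) f) le_j).
rewrite (transf_ncoef hk (torus t) f le_j) /subst_coef !mxE /=.
rewrite iter_polarl iter_polarr addn0.
rewrite mulf_eq0 (negbTE (natr_neq0 hk _)) ?bin_gt0 //=.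
case: ltnP => [_ /eqP ->|le_2j _]; first by rewrite !mulr0.
rewrite [RHS]mulrCA; congr (_ * _); rewrite mulrA; congr (_ * _).
rewrite -addnn subnDA exprVn -expfB_cond //.
by rewrite (negbTE t0) add0n leq_subRL // addnn.
Qed.

Lemma nullcone_of_coef (F : binform k 5) (G : binform k 3) :
  (forall j, (2 < j <= 5)%N -> ncoef F j = 0) ->
  (forall j, (1 < j <= 3)%N -> ncoef G j = 0) ->
  nullcone53 (F, G).
Proof.
move=> hF hG d P d_gt0 homP invP.
have bF j : (2 < j <= 5)%N -> bincoef F j = 0.
  by move=> hj; have /andP[_ le_j] := hj; rewrite (ncoefE hk F le_j) hF ?mulr0.
have bG j : (1 < j <= 3)%N -> bincoef G j = 0.
  by move=> hj; have /andP[_ le_j] := hj; rewrite (ncoefE hk G le_j) hG ?mulr0.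
(* Both degrees are odd, so weight 0 arises only by truncation, at coordinates that vanish by
   hypothesis. *)
pose w (i : 'I_(6 + 4)) :=
  match split i with inl j => 5 - j.*2 | inr j => 3 - j.*2 end%N.
apply: (@meval_contract _ P d (coords53 (F, G)) w _ d_gt0 homP) => [i|t t0].
  rewrite /w /coords53; case: (split i) => -[j lt_j] /= /eqP; rewrite subn_eq0 => lt_2j.
    by apply: bF; move: j lt_j lt_2j; do 6?[case=> [|]].
  by apply: bG; move: j lt_j lt_2j; do 4?[case=> [|]].
rewrite -(invP _ (det_torus t0)); apply: meval_eq => i; rewrite /coords53 /w.
case: (split i) => -[j lt_j] /=; apply/esym.
  apply: (@bincoef_torus _ _ j t t0 lt_j); apply/implyP => lt_2j; apply/eqP/bF.
  by move: j lt_j lt_2j; do 6?[case=> [|]].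
apply: (@bincoef_torus _ _ j t t0 lt_j); apply/implyP => lt_2j; apply/eqP/bG.
by move: j lt_j lt_2j; do 4?[case=> [|]].
Qed.

End Torus.

(** * Solving the equations on coefficients *)

Section Algebra.
Variable k : fieldType.
Hypothesis hk : [pchar k] =i pred0.
Implicit Types a b : nat -> k.

Let n2 : 2 != 0 :> k. Proof. exact: natr_neq0. Qed.
Let n3 : 3 != 0 :> k. Proof. exact: natr_neq0. Qed.

Lemma disc_eq0 a : a 2%N = 0 -> contr2 a a 0%N = 0 -> a 1%N = 0.
Proof.
rewrite /contr2 => -> /eqP; rewrite mulr0 mul0r addr0 add0r oppr_eq0 mulf_eq0.
by rewrite (negbTE n2) mulf_eq0 orbb => /eqP.
Qed.

(** The relations make the coefficients a geometric progression, so each product in the conclusion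
    has the same value and 1 - 4 + 3 = 0. *)
Lemma perfect_fifth_power (a0 a1 a2 a3 a4 a5 : k) : a5 != 0 ->
  a3 * a5 = a4 ^+ 2 -> a2 * a5 = a3 * a4 ->
  a1 * a5 = 4 * (a2 * a4) - 3 * a3 ^+ 2 ->
  a0 * a5 = 3 * (a1 * a4) - 2 * (a2 * a3) ->
  a0 * a4 - 4 * (a1 * a3) + 3 * a2 ^+ 2 = 0.
Proof.
move=> a5_neq0 /(canRL (mulfK a5_neq0)) -> /(canRL (mulfK a5_neq0)) ->.
move=> /(canRL (mulfK a5_neq0)) -> /(canRL (mulfK a5_neq0)) ->.
by field.
Qed.

Lemma quintic_i_neq0 a : let i := quad5 a in let t := hess (contr2 a i) in
  i 0%N != 0 -> i 2%N = 0 -> contr2 i i 0%N = 0 ->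
  contr2 i t 0%N = 0 -> contr2 t t 0%N = 0 ->
  [/\ a 3%N = 0, a 4%N = 0 & a 5%N = 0].
Proof.
move=> i t i0_neq0 i2 /(disc_eq0 i2) i1 it tt.
have t2 : t 2%N = 0.
  apply: (mulfI i0_neq0); move: it; rewrite /contr2 i1 i2 !mul0r mulr0 subr0 addr0.
  by rewrite mulr0.
have t1 := disc_eq0 t2 tt.
(* As i is a multiple of x^2, j is proportional to the second y-derivative of F. Then t2 and t1 give
   [A] and [B], while i2 and i1 give [C] and [D]. *)
have jE p : contr2 a i p = i 0%N * a p.+2.
  by rewrite /contr2 i1 i2 !mulr0 subr0 add0r mulrC.
have A : a 3%N * a 5%N = a 4%N ^+ 2.
  apply/eqP; rewrite -subr_eq0; apply/eqP.
  apply: (mulfI (mulf_neq0 n2 (expf_neq0 2 i0_neq0))).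
  by rewrite mulr0 -t2 /t /hess /= !jE; ring.
have B : a 2%N * a 5%N = a 3%N * a 4%N.
  apply/eqP; rewrite -subr_eq0; apply/eqP; apply: (mulfI (expf_neq0 2 i0_neq0)).
  by rewrite mulr0 -t1 /t /hess /= !jE; ring.
have C : a 1%N * a 5%N = 4 * (a 2%N * a 4%N) - 3 * a 3%N ^+ 2.
  apply/eqP; rewrite -subr_eq0; apply/eqP/(mulfI n2).
  by rewrite mulr0 -i2 /i /quad5 /=; ring.
have D : a 0%N * a 5%N = 3 * (a 1%N * a 4%N) - 2 * (a 2%N * a 3%N).
  by apply/eqP; rewrite -subr_eq0; apply/eqP; rewrite -i1 /i /quad5 /=; ring.
have a5 : a 5%N = 0.
  apply/eqP; apply: contraNT i0_neq0 => a5_neq0.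
  by rewrite /i /quad5 /= (perfect_fifth_power a5_neq0 A B C D) mulr0.
have a4 : a 4%N = 0 by apply/eqP; rewrite -[_ == _](expf_eq0 _ 2) -A a5 mulr0.
split=> //; apply/eqP; rewrite -[_ == _](expf_eq0 _ 2); apply/eqP/(mulfI n3).
by move: C; rewrite a4 a5 !mulr0 sub0r => /esym/eqP; rewrite oppr_eq0 => /eqP.
Qed.

Lemma quintic_i_eq0 a : quad5 a =1 (fun=> 0) -> a 5%N = 0 ->
  exists s t u v : k, s * v - t * u = 1 /\
    (forall m, (2 < m <= 5)%N -> subst_coef s t u v 5 a m = 0).
Proof.
move=> i0 a5.
have A : a 0%N * a 4%N = 4 * (a 1%N * a 3%N) - 3 * a 2%N ^+ 2.
  apply/eqP; rewrite -subr_eq0; apply/eqP/(mulfI n2).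
  by rewrite mulr0 -(i0 0%N) /quad5 /=; ring.
have B : a 1%N * a 4%N = 2 / 3 * (a 2%N * a 3%N).
  apply/eqP; rewrite -subr_eq0; apply/eqP/(mulfI n3).
  by apply: oppr_inj; rewrite mulr0 oppr0 -(i0 1%N) /quad5 /= a5; field.
have C : a 2%N * a 4%N = 3 / 4 * a 3%N ^+ 2.
  apply/eqP; rewrite -subr_eq0; apply/eqP/(mulfI (natr_neq0 hk (isT : 0 < 8)%N)).
  apply: oppr_inj; rewrite mulr0 oppr0 -(i0 2%N) /quad5 /= a5.
  by field; apply: natr_neq0.
have [a4|a4_neq0] := eqVneq (a 4%N) 0.
  exists 1, 0, 0, 1; split; first by rewrite mulr1 mulr0 subr0.
  have a3 : a 3%N = 0.
    apply/eqP; rewrite -[_ == _](expf_eq0 _ 2); apply/eqP.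
    apply: (mulfI (mulf_neq0 n3 (invr_neq0 (natr_neq0 hk (isT : 0 < 4)%N)))).
    by rewrite mulr0 -C a4 mulr0.
  by do 6?[case=> [|]] => //= _; rewrite /subst_coef /= /polar; ring: a3 a4 a5.
(* Here F is a multiple of x (a3 x + 2 a4 y)^4: move its multiple root. *)
exists 0, 1, (-1), (- (a 3%N / (2 * a 4%N))).
split; first by rewrite mul0r mulrN mul1r opprK add0r.
have a2E := canRL (mulfK a4_neq0) C.
have a1E := canRL (mulfK a4_neq0) B.
have a0E := canRL (mulfK a4_neq0) A.
do 6?[case=> [|]] => //= _; rewrite /subst_coef /= /polar a0E a1E a2E a5.
all: by field; rewrite ?a4_neq0 ?n2 ?n3 ?natr_neq0.
Qed.

(** A nonzero b3 would make G a cube, whose Hessian is zero. *)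
Lemma cubic_h_neq0 b : let h := hess b in h 0%N != 0 -> h 2%N = 0 ->
  contr2 h h 0%N = 0 -> b 2%N = 0 /\ b 3%N = 0.
Proof.
move=> h h0_neq0 h2 /(disc_eq0 h2) h1.
have A : b 1%N * b 3%N = b 2%N ^+ 2.
  by apply/eqP; rewrite -subr_eq0; apply/eqP/(mulfI n2); rewrite mulr0.
have B : b 0%N * b 3%N = b 1%N * b 2%N by apply/eqP; rewrite -subr_eq0; apply/eqP.
have b3 : b 3%N = 0.
  apply/eqP; apply: contraNT h0_neq0 => b3_neq0.
  rewrite /h /hess /= (canRL (mulfK b3_neq0) B) (canRL (mulfK b3_neq0) A).
  by apply/eqP; field.
by split=> //; apply/eqP; rewrite -[_ == _](expf_eq0 _ 2) -A b3 mulr0.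
Qed.

Lemma cubic_h_eq0 b : hess b 2%N = 0 -> b 3%N = 0 -> b 2%N = 0.
Proof.
move=> h2 b3; apply/eqP; rewrite -[_ == _](expf_eq0 _ 2); apply/eqP.
by apply: (mulfI n2); apply: oppr_inj; rewrite mulr0 oppr0 -h2 /hess /= b3; ring.
Qed.

Lemma mixed_invariants a b : invariants a b = nseq 10 0 ->
  a 3%N = 0 -> a 4%N = 0 -> a 5%N = 0 ->
  [|| a 0%N != 0, a 1%N != 0 | a 2%N != 0] -> b 2%N = 0 /\ b 3%N = 0.
Proof.
case=> _ _ _ _ ih jb qq ql qh hl a3 a4 a5 a_neq0.
set i := quad5 a in ih jb; set h := hess b in ih qh hl.
set q := contr3 a b in qq ql qh.
have iE : i =1 (fun p => if p is 0 then 6 * a 2%N ^+ 2 else 0).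
  by case=> [|[|[|p]]]; rewrite /i /quad5 /= ?nth_nil //; ring: a3 a4 a5.
have q0E : q 0%N = a 0%N * b 3%N - 3 * (a 1%N * b 2%N) + 3 * (a 2%N * b 1%N).
  by rewrite /q /contr3 a3 mul0r subr0.
have q1E : q 1%N = a 1%N * b 3%N - 3 * (a 2%N * b 2%N).
  by rewrite /q /contr3 a3 a4 !mul0r mulr0 subr0 addr0.
have q2E : q 2%N = a 2%N * b 3%N.
  by rewrite /q /contr3 a3 a4 a5 !mul0r !mulr0 !subr0 addr0.
(* If a2 <> 0, the root of F is exactly triple and i is a nonzero multiple of x^2: (j,G)_3 then
   isolates b3, and (i,h)_2 isolates h2. *)
have [a2|a2_neq0] := eqVneq (a 2%N) 0; last first.
  have i0_neq0 : i 0%N != 0 by rewrite iE mulf_neq0 ?expf_neq0 ?natr_neq0.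
  have b3 : b 3%N = 0.
    apply: (mulfI (mulf_neq0 a2_neq0 i0_neq0)); rewrite mulr0 -jb.
    by rewrite /contr3 /contr2 a3 a4 a5 (iE 1%N) (iE 2%N); ring.
  split=> //; apply: cubic_h_eq0 => //; apply: (mulfI i0_neq0).
  by rewrite -/h mulr0 -ih /contr2 (iE 1%N) (iE 2%N); ring.
rewrite a2 eqxx orbF in a_neq0.
rewrite a2 mul0r mulr0 addr0 in q0E; rewrite a2 mul0r mulr0 subr0 in q1E.
rewrite a2 mul0r in q2E.
have q1 := disc_eq0 q2E qq.
(* Now F has a root of order at least 4, and q is a multiple of x^2. A nonzero b3 would force F = a0
   x^5, contradicting the eighth invariant. *)
have [b3|b3_neq0] := eqVneq (b 3%N) 0; last first.
  have a1 : a 1%N = 0 by apply: (mulIf b3_neq0); rewrite mul0r -q1E.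
  have q0 : q 0%N = a 0%N * b 3%N by rewrite q0E a1 mul0r mulr0 subr0.
  have a0_neq0 : a 0%N != 0 by rewrite a1 eqxx orbF in a_neq0.
  have q0_neq0 : q 0%N != 0 by rewrite q0 mulf_neq0.
  have /eqP : q 0%N ^+ 3 * b 3%N ^+ 2 = 0.
    by rewrite -ql /eval2 /contr2 q1 q2E; ring.
  by rewrite mulf_eq0 !expf_eq0 /= (negbTE q0_neq0) (negbTE b3_neq0).
(* A nonzero b2 gives h2 <> 0; (q,h)_2 then kills q0 and hence a1, and the last invariant kills the
   remaining a0. *)
split=> //; apply/eqP; apply: contraT => b2_neq0.
have h2_neq0 : h 2%N != 0.
  by rewrite /h /hess /= b3 mulr0 sub0r mulf_neq0 // oppr_eq0 expf_neq0.
have q0 : q 0%N = 0.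
  by apply: (mulIf h2_neq0); rewrite mul0r -qh /contr2 q1 q2E; ring.
have a1 : a 1%N = 0.
  apply: (mulIf b2_neq0); apply: (mulfI n3); apply: oppr_inj.
  by rewrite mul0r mulr0 oppr0 -q0 q0E b3; ring.
rewrite a1 eqxx orbF in a_neq0.
have /eqP : a 0%N ^+ 2 * h 2%N ^+ 5 = 0.
  by rewrite -hl /eval2 /contr2 a1 a2 a3 a4 a5; ring.
by rewrite mulf_eq0 !expf_eq0 /= (negbTE a_neq0) (negbTE h2_neq0).
Qed.

End Algebra.

(** * Moving roots to (0 : 1) and assembling the equivalence *)

Section Main.
Variable k : closedFieldType.
Hypothesis hk : [pchar k] =i pred0.
Implicit Types g : 'M[k]_2.

(** The last substituted coefficient is the value of the form at g(0 : 1). When a0 = 0, the point (1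
    : 0) is a root. *)
Lemma exists_root n (a : nat -> k) : (0 < n)%N -> exists g, \det g = 1 /\
  subst_coef (g ord0 ord0) (g ord0 ord_max) (g ord_max ord0) (g ord_max ord_max)
    n a n = 0.
Proof.
move=> n_gt0; have [a0|a0_neq0] := eqVneq (a 0%N) 0.
  exists (mx2 0 1 (-1) 0); split; first by rewrite det_mx2 mul0r mul1r opprK add0r.
  by rewrite /subst_coef subnn !mxE /= iter_polarl a0 mulr0.
(* Setting y = 1 and dividing by a0 gives a monic equation; its lower terms are passed with reversed
   sign. *)
have [t tE] := @solve_monicpoly k n
  (fun i => - ('C(n, i)%:R * a (n - i)%N) / a 0%N) n_gt0.
exists (mx2 1 t 0 1); split; first by rewrite det_mx2 !mulr1 mulr0 subr0.
rewrite subst_coefE subnn !mxE /= mul1r scale1r addrC exprDn linear_sum /=.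
under eq_bigr => i _.
  rewrite raddfMn /= -polyC_exp mulrC mul_polyC linearZ /= umbralXn.
  over.
rewrite big_ord_recr /= subnn binn mulr1n tE mulr_suml -big_split big1 //= => i _.
by rewrite -mulr_natl; field.
Qed.

Lemma quad5_act g (F : binform k 5) : \det g = 1 ->
  transf_mx g 2
    (quad5 (ncoef F)) (quad5 (ncoef (act g F))).
Proof. by rewrite det2E => dg; apply: transf_quad5 => //; apply: transf_ncoef. Qed.

Lemma hess_act g (G : binform k 3) : \det g = 1 ->
  transf_mx g 2
    (hess (ncoef G)) (hess (ncoef (act g G))).
Proof. by rewrite det2E => dg; apply: transf_hess => //; apply: transf_ncoef. Qed.

Lemma transf_eq0 s t u v (a a' : nat -> k) :
  transf s t u v 2 a a' -> a 0%N = 0 -> a 1%N = 0 -> a 2%N = 0 ->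
  forall m, (m <= 2)%N -> a' m = 0.
Proof.
move=> ha a0 a1 a2 m le_m; rewrite ha //.
by move: m le_m; do 3?[case=> [|] //] => _; rewrite /subst_coef /= /polar a0 a1 a2; ring.
Qed.

Lemma quintic_null (F : binform k 5) (G : binform k 3) :
  invariants (ncoef F) (ncoef G) = nseq 10 0 ->
  exists g, \det g = 1 /\ (forall j, (2 < j <= 5)%N -> ncoef (act g F) j = 0).
Proof.
have [g [dg g0]] := @exists_root 2 (quad5 (ncoef F)) isT.
rewrite -(invariants_act hk F G dg) => -[ii it tt _ _ _ _ _ _ _].
have i2 : quad5 (ncoef (act g F)) 2%N = 0 by rewrite (quad5_act F dg).
have [i0|i0_neq0] := eqVneq (quad5 (ncoef (act g F)) 0%N) 0; last first.
  have [a3 a4 a5] := quintic_i_neq0 hk i0_neq0 i2 ii it tt.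
  by exists g; split=> //; do 6?[case=> [|]] => //=.
(* Here i = 0 singles out no point, so a root of F is moved to (0 : 1) instead. *)
have i1 := disc_eq0 hk i2 ii.
have [h [dh h0]] := @exists_root 5 (ncoef (act g F)) isT.
have a5 : ncoef (act h (act g F)) 5%N = 0 by rewrite (transf_ncoef hk).
have i_eq0 : quad5 (ncoef (act h (act g F))) =1 (fun=> 0).
  move=> m; have [le_m|lt_m] := leqP m 2; first exact: (transf_eq0 (quad5_act _ dh)).
  by rewrite /quad5 nth_default.
have [s [t [u [v [dl l0]]]]] := quintic_i_eq0 hk i_eq0 a5.
exists (g *m (h *m mx2 s t u v)).
split; first by rewrite !det_mulmx dg dh det_mx2 dl !mul1r.
move=> j hj; have /andP[_ le_j] := hj; rewrite -!act_comp.
by rewrite (transf_ncoef hk) // !mxE /= l0.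
Qed.

(** The double root of the Hessian is moved to (0 : 1). If the Hessian is zero, a root of G is moved
    there, and h2 = -2 b2^2 makes it multiple. *)
Lemma cubic_null (G : binform k 3) :
  contr2 (hess (ncoef G)) (hess (ncoef G)) 0%N = 0 ->
  exists g, \det g = 1 /\ (forall j, (1 < j <= 3)%N -> ncoef (act g G) j = 0).
Proof.
have [g [dg g0]] := @exists_root 2 (hess (ncoef G)) isT.
have hg := hess_act G dg; rewrite -(contr2_inv _ hg hg) -?det2E // => hh.
have h2 : hess (ncoef (act g G)) 2%N = 0 by rewrite hg.
have [h0|h0_neq0] := eqVneq (hess (ncoef (act g G)) 0%N) 0; last first.
  have [b2 b3] := cubic_h_neq0 hk h0_neq0 h2 hh.
  by exists g; split=> //; do 4?[case=> [|]] => //=.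
have h1 := disc_eq0 hk h2 hh.
have [l [dl l0]] := @exists_root 3 (ncoef (act g G)) isT.
have b3 : ncoef (act l (act g G)) 3%N = 0 by rewrite (transf_ncoef hk).
have b2 := cubic_h_eq0 hk (transf_eq0 (hess_act _ dl) h0 h1 h2 (leqnn 2)) b3.
exists (g *m l); split; first by rewrite det_mulmx dg dl mulr1.
by rewrite -act_comp; do 4?[case=> [|]] => //=.
Qed.

Lemma binform_eq0 n (f : binform k n) :
  (forall j, (j <= n)%N -> ncoef f j = 0) -> f = 0.
Proof.
move=> f0; apply: val_inj; rewrite [LHS]binformE big1 // => j _.
have le_j : (j <= n)%N by rewrite -ltnS.
by rewrite (ncoefE hk f le_j) f0 ?mulr0 ?scale0r.
Qed.

Lemma col2_neq0 g : \det g = 1 -> col2 g != 0.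
Proof.
rewrite det2E => dg; apply/eqP => /rowP c0; have := oner_neq0 k.
have := c0 ord0; have := c0 ord_max; rewrite !mxE -dg => -> ->.
by rewrite mulr0 mul0r subr0 eqxx.
Qed.

(** With [p] as second column, the inverse of a nonzero coordinate, up to sign, completes a matrix
    of determinant 1. *)
Lemma exists_col2 (p : 'rV[k]_2) : p != 0 -> exists g, \det g = 1 /\ col2 g = p.
Proof.
move=> p_neq0.
have colE s u : col2 (mx2 s (p ord0 ord0) u (p ord0 ord_max)) = p.
  apply/rowP => j; rewrite !mxE /= (_ : ord0 = 0) //.
  by case: j => [[|[|//]] lt_j] /=; congr (p _ _); apply: val_inj.
have [p1|p1_neq0] := eqVneq (p ord0 ord_max) 0; last first.
  exists (mx2 (p ord0 ord_max)^-1 (p ord0 ord0) 0 (p ord0 ord_max)).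
  by rewrite det_mx2 mulVf // mulr0 subr0 colE.
have [p0|p0_neq0] := eqVneq (p ord0 ord0) 0.
  case/eqP: p_neq0; apply/rowP => j; rewrite mxE -(colE 0 0) !mxE /= p0 p1.
  by case: ifP.
exists (mx2 0 (p ord0 ord0) (- (p ord0 ord0)^-1) (p ord0 ord_max)).
by rewrite det_mx2 mul0r sub0r mulrN opprK divff // colE.
Qed.

End Main.

Theorem theorem4p1 (k : closedFieldType) (hk : [pchar k] =i pred0)
    (F : binform k 5) (G : binform k 3) :
  nullcone53 (F, G) <->
  exists p : 'rV[k]_2, [/\ p != 0, mult_ge p F 3 & mult_ge p G 2].
Proof.
split=> [/(nullcone_invariants hk) inv0|[p [p_neq0]]]; last first.
  have [g [dg <-]] := exists_col2 p_neq0.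
  rewrite !mult_geP ?col2_neq0 // => vF vG; apply: (nullcone_act dg).
  apply: (nullcone_of_coef hk).
    exact: (vanishesP hk F dg (isT : 3 <= 5)%N).1 vF.
  exact: (vanishesP hk G dg (isT : 2 <= 3)%N).1 vG.
have sol g : \det g = 1 -> (forall j, (2 < j <= 5)%N -> ncoef (act g F) j = 0) ->
    (forall j, (1 < j <= 3)%N -> ncoef (act g G) j = 0) ->
    exists p : 'rV[k]_2, [/\ p != 0, mult_ge p F 3 & mult_ge p G 2].
  move=> dg hF hG; exists (col2 g); split; first exact: col2_neq0.
    rewrite mult_geP ?col2_neq0 //.
    exact: (vanishesP hk F dg (isT : 3 <= 5)%N).2 hF.
  rewrite mult_geP ?col2_neq0 //.
  exact: (vanishesP hk G dg (isT : 2 <= 3)%N).2 hG.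
have [g [dg hF]] := quintic_null hk inv0.
(* If F = 0, then [g] has no relation to G, and the point is taken from the discriminant of G. *)
have [F0|] := boolP [&& ncoef (act g F) 0%N == 0, ncoef (act g F) 1%N == 0
                      & ncoef (act g F) 2%N == 0].
  have gF0 : act g F = 0.
    apply: (binform_eq0 hk) => j le_j.
    have [le_2j|lt_2j] := leqP j 2; last by rewrite hF ?lt_2j.
    case/and3P: F0 => /eqP ? /eqP ? /eqP ?.
    by move: j le_j le_2j; do 3?[case=> [|]].
  have FE : F = 0 by rewrite -(act_inj F dg) gF0 act0.
  have [_ _ _ hh _ _ _ _ _ _] := inv0.
  have [l [dl hG]] := cubic_null hk hh.
  apply: (sol l dl _ hG) => j _.
  by rewrite FE act0 /ncoef /bincoef mcoeff0 mul0r.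
rewrite !negb_and => aF_neq0; apply: (sol g dg hF).
rewrite -(invariants_act hk F G dg) in inv0.
have [b2 b3] := mixed_invariants hk inv0 (hF 3%N isT) (hF 4%N isT) (hF 5%N isT) aF_neq0.
by do 4?[case=> [|]].
Qed.
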